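(* Let $D$ be a delta-matroid on $[n,\overline{n}]$ which has an enveloping matroid. Write $U_D(u,0)=a_n+a_{n-1}u+\dots+a_0u^n$. Then for every $k\in\{1,\dots,n-1\}$, $$a_k^2\ge\frac{2n-k+1}{2n-k}\cdot\frac{k+1}{k}\,a_{k+1}a_{k-1}.$$
   Context: Let $[n,\overline{n}]=\{1,\dots,n,\overline{1},\dots,\overline{n}\}$ with involution $a\mapsto\overline{a}$; $\overline{S}=\{\overline{a}:a\in S\}$. A subset of $[n,\overline{n}]$ is admissible if it contains at most one of $i,\overline{i}$ for each $i$; $\operatorname{AdS}_n$ is the set of admissible subsets. In $\mathbb{R}^n$ set $e_{\overline{i}}=-e_i$, $e_S=\sum_{a\in S}e_a$. A delta-matroid $D$ on $[n,\overline{n}]$ is a nonempty collection $\mathcal{F}$ of admissible sets of size $n$ (feasible sets) such that $P(D)=\operatorname{Conv}\{e_B:B\in\mathcal{F}\}$ has all edges parallel to some $e_i$ or $e_i\pm e_j$. Its rank function is $g_D(S)=\max_{B\in\mathcal{F}}(|S\cap B|-|\overline{S}\cap B|)$ for $S\in\operatorname{AdS}_n$. The $U$-polynomial is $U_D(u,v)=\sum_{S\in\operatorname{AdS}_n}u^{n-|S|}v^{(|S|-g_D(S))/2}$ (a polynomial; at $v=0$ the terms with $g_D(S)=|S|$ contribute $u^{n-|S|}$). For $S\subseteq[n,\overline{n}]$ let $u_S\in\mathbb{R}^{[n,\overline{n}]}$ be its indicator vector; for a matroid $M$ on the $2n$-element ground set $[n,\overline{n}]$ let $P(M)=\operatorname{Conv}\{u_B:B\text{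 a basis of }M\}$. Let $\operatorname{env}\colon\mathbb{R}^{[n,\overline{n}]}\to\mathbb{R}^n$ be $(x_1,\dots,x_n,x_{\overline{1}},\dots,x_{\overline{n}})\mapsto(x_1-x_{\overline{1}},\dots,x_n-x_{\overline{n}})$. A matroid $M$ on $[n,\overline{n}]$ is an enveloping matroid for $D$ if $\operatorname{env}(P(M))=P(D)$. *)

(* Defs.v *)
From HB Require Import structures.
From mathcomp Require Import all_boot all_order all_algebra.
From mathcomp Require Import reals.
Set Implicit Arguments. Unset Strict Implicit. Unset Printing Implicit Defensive.
Import Order.TTheory GRing.Theory Num.Theory.
Local Open Scope ring_scope.

(* The ground set [n, nbar]: (i, false) encodes i, (i, true) encodes ibar. *)
Definition elt (n : nat) : finType := ('I_n * bool)%type.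
Definition ebar n (a : elt n) : elt n := (a.1, ~~ a.2).
Definition setbar n (S : {set elt n}) : {set elt n} := [set ebar a | a in S].

Definition admissible n (S : {set elt n}) : bool :=
  [forall i : 'I_n, ~~ (((i, false) \in S) && ((i, true) \in S))].

(* e_S in R^n, with e_{ibar} = - e_i *)
Definition eS (R : realType) n (S : {set elt n}) : 'I_n -> R :=
  fun i => ((i, false) \in S)%:R - ((i, true) \in S)%:R.

Definition ev (R : realType) n (i : 'I_n) : 'I_n -> R := fun j => (j == i)%:R.

Definition in_hull (R : realType) (I : finType) (m : finType) (P : {set I})
    (f : I -> m -> R) (x : m -> R) : Prop :=
  exists lam : I -> R,
    (forall B, B \in P -> 0 <= lam B) /\ \sum_(B in P) lam B = 1 /\
    forall k, x k = \sum_(B in P) lam B * f B k.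

Definition dotv (R : realType) n (w x : 'I_n -> R) : R := \sum_i w i * x i.

Definition allowed_dir (R : realType) n (d : 'I_n -> R) : Prop :=
  exists c : R,
    (exists i, forall k, d k = c * ev R i k) \/
    (exists i j, i != j /\
       ((forall k, d k = c * (ev R i k + ev R j k)) \/
        (forall k, d k = c * (ev R i k - ev R j k)))).

Definition maximizes (R : realType) n (F : {set {set elt n}}) (w : 'I_n -> R)
    (B : {set elt n}) : Prop :=
  B \in F /\ forall B', B' \in F -> dotv w (eS R B') <= dotv w (eS R B).

(* Every edge of P(F) = Conv{e_B : B in F} is parallel to some e_i or e_i +- e_j.
   The faces of the polytope are exactly the sets of maximizers of linear
   functionals w; a face is an edge iff the vertices e_B in it are (at least two
   and) collinear; the edge direction is then e_B2 - e_B1. *)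
Definition edges_ok (R : realType) n (F : {set {set elt n}}) : Prop :=
  forall (w : 'I_n -> R) (B1 B2 : {set elt n}),
    maximizes F w B1 -> maximizes F w B2 ->
    (exists k, eS R B1 k != eS R B2 k) ->
    (forall B, maximizes F w B ->
       exists t : R, forall k, eS R B k = eS R B1 k + t * (eS R B2 k - eS R B1 k)) ->
    allowed_dir (fun k => eS R B2 k - eS R B1 k).

Definition delta_matroid (R : realType) n (F : {set {set elt n}}) : Prop :=
  F != set0 /\
  (forall B, B \in F -> admissible B /\ #|B| = n) /\
  edges_ok R F.

(* rank function g_D(S) = max_{B in F} (|S cap B| - |Sbar cap B|).  The seed
   -n is below every term (|Sbar cap B| <= |B| = n), so for nonempty F this is
   the maximum. *)
Definition rank_fn n (F : {set {set elt n}}) (S : {set elt n}) : int :=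
  \big[Num.max/ - (n%:Z)]_(B in F) ((#|S :&: B|)%:Z - (#|setbar S :&: B|)%:Z).

(* U_D(u,v) as a polynomial in u with coefficients polynomials in v *)
Definition Upoly n (F : {set {set elt n}}) : {poly {poly int}} :=
  \sum_(S : {set elt n} | admissible S)
     ((('X^(`|(#|S|)%:Z - rank_fn F S|%N %/ 2)) : {poly int})%:P * 'X^(n - #|S|)).

Definition Upoly_v0 n (F : {set {set elt n}}) : {poly int} :=
  map_poly (fun p : {poly int} => p.[0]) (Upoly F).

Definition Ucoef n (F : {set {set elt n}}) (k : nat) : int := (Upoly_v0 F)`_(n - k).

Definition matroid_bases n (BM : {set {set elt n}}) : Prop :=
  BM != set0 /\
  forall B1 B2, B1 \in BM -> B2 \in BM ->
    forall x, x \in B1 :\: B2 ->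
      exists2 y, y \in B2 :\: B1 & (B1 :\ x) :|: [set y] \in BM.

Definition uS (R : realType) n (S : {set elt n}) : elt n -> R := fun a => (a \in S)%:R.

Definition env (R : realType) n (x : elt n -> R) : 'I_n -> R :=
  fun i => x (i, false) - x (i, true).

Definition enveloping_matroid (R : realType) n (F : {set {set elt n}})
    (BM : {set {set elt n}}) : Prop :=
  matroid_bases BM /\
  forall y : 'I_n -> R,
    (exists x, in_hull BM (@uS R n) x /\ forall i, y i = env x i) <->
    in_hull F (@eS R n) y.

(* Main.v *)
Require Import Defs.
From HB Require Import structures.
From mathcomp Require Import all_boot all_order all_algebra.
From mathcomp Require Import reals.
From mathcomp Require Import zify ring lra.
Set Implicit Arguments. Unset Strict Implicit. Unset Printing Implicit Defensive.
Import Order.TTheory GRing.Theory Num.Theory.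
Local Open Scope ring_scope.

(* If [M] is an enveloping matroid of [D], then an admissible set is contained in
   a feasible set of [D] iff it is independent in [M] (a feasible set maximizing
   [e_S] must contain [S], by basis exchange in [M]), so [a_k] counts the
   admissible independent sets of [M] of size [k].

   The polynomial [f = \sum_I w_0 ^ (2n - #|I|) * \prod_(e in I) w_e] over the
   independent sets [I] of [M] is Lorentzian: its quadratic derivatives satisfy
   the reversed Cauchy-Schwarz inequality at [w_0], by Cauchy-Schwarz over the
   parallel classes of a contraction of [M], and this passes from coordinate
   derivatives to derivatives along all nonnegative vectors because, for a
   symmetric trilinear [T], it passes from [T a] and [T b] to [T (a + b)].
   Substitute [y_i] for [w_i] and [w_ibar] and keep the part that is multi-affine
   in [y]: this subtracts from each quadratic derivative a nonnegative
   combination of the [y_i ^ 2], hence preserves the inequality. The result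
   restricts to [\sum_k a_k w_0 ^ (2n - k) y ^ k] on the diagonal, and its
   inequality between the directions [w_0] and [y_1 = .. = y_n] is the
   ultra-log-concavity of [a] of order [2n]. *)

(** * Reversed Cauchy-Schwarz inequalities *)

Section Forms.
Variables (R : realFieldType) (V : lmodType R).
Implicit Types (A B : V -> V -> R) (x y z : V).

Definition symmetric_bilinear B : Prop :=
  (forall x y, B x y = B y x) /\
  (forall c x y z, B (c *: x + y) z = c * B x z + B y z).

(** In finite dimension and for symmetric bilinear [B]: at most one positive eigenvalue. *)
Definition hyperbolic B : Prop :=
  forall x y, 0 < B x x -> B x x * B y y <= B x y ^+ 2.

Lemma bilinearPr B c x y z : symmetric_bilinear B ->
  B z (c *: x + y) = c * B z x + B z y.
Proof. by case=> sB lB; rewrite sB lB !(sB z). Qed.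

Lemma bilinearZr B c x z : symmetric_bilinear B -> B z (c *: x) = c * B z x.
Proof.
move=> bB; rewrite -[c *: x]addr0 bilinearPr //.
by have := bilinearPr (-1) 0 0 z bB; rewrite scaler0 addr0; lra.
Qed.

Lemma bilinear_sqr B c x y : symmetric_bilinear B ->
  B (c *: x + y) (c *: x + y) = c ^+ 2 * B x x + 2 * c * B x y + B y y.
Proof.
move=> bB; rewrite bilinearPr //; case: (bB) => sB lB.
by rewrite !lB (sB y x); ring.
Qed.

(** Such a form is nonpositive on the orthogonal of [a]. That orthogonal contains
    [u = B a y *: x - B a x *: y], and [B x x * B u u <= 0] rearranges to a square plus [B a x ^+ 2]
    times the wanted difference. *)
Lemma hyperbolic_of_one B a : symmetric_bilinear B -> 0 < B a a ->
  (forall y, B a a * B y y <= B a y ^+ 2) -> hyperbolic B.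
Proof.
move=> bB a0 Ha x y x0; have [sB lB] := bB.
have neg u : B a u = 0 -> B u u <= 0.
  by move=> au; have := Ha u; rewrite au expr0n /= pmulr_rle0.
have ax0 : 0 < B a x ^+ 2 by apply: lt_le_trans (Ha x); apply: mulr_gt0.
pose u := B a y *: x + (- B a x) *: y.
have auE : B a u = 0 by rewrite bilinearPr // bilinearZr //; ring.
have := neg u auE; rewrite (bilinear_sqr _ _ _ bB) !bilinearZr // (sB (_ *: _) y).
rewrite bilinearZr // => H.
have {H} H : (B a y * B x x - B a x * B x y) ^+ 2
   + B a x ^+ 2 * (B x x * B y y - B x y ^+ 2) <= 0.
  have := ler_wpM2l (ltW x0) H; rewrite mulr0; apply: le_trans.
  by rewrite le_eqVlt; apply/orP; left; apply/eqP; ring.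
have := sqr_ge0 (B a y * B x x - B a x * B x y) => H2.
have : B a x ^+ 2 * (B x x * B y y - B x y ^+ 2) <= 0 by lra.
by rewrite pmulr_rle0 // subr_le0.
Qed.

Lemma hyperbolic_orth_le0 B x y : hyperbolic B -> 0 < B x x -> B x y = 0 ->
  B y y <= 0.
Proof.
by move=> hB x0 xy; have := hB x y x0; rewrite xy expr0n /= pmulr_rle0.
Qed.

(** The form is negative semidefinite on the orthogonal of [x], so an isotropic vector there pairs
    to zero with that orthogonal, and with [x] by assumption. *)
Lemma hyperbolic_orth_isotropic B x y z : symmetric_bilinear B ->
  hyperbolic B -> 0 < B x x -> B x y = 0 -> B y y = 0 -> B y z = 0.
Proof.
move=> bB hB x0 xy yy; have [sB lB] := bB.
pose z' := (- (B x z / B x x)) *: x + z.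
have xz' : B x z' = 0.
  by rewrite bilinearPr // mulNr divfK ?gt_eqF // addNr.
have yz' : B y z' = B y z by rewrite bilinearPr // (sB y x) xy mulr0 add0r.
rewrite -yz'; apply/eqP; case: (eqVneq (B y z') 0) => // b0.
have c0 := hyperbolic_orth_le0 hB x0 xz'.
(* With [b = B y z'] and [c = B z' z' <= 0], this [s] turns [s ^ 2 * c + 2 * s * b] into
   [(b / (1 - c)) ^ 2 * (2 - c)], which is positive. *)
pose s := B y z' / (1 - B z' z').
have d0 : 0 < 1 - B z' z' by lra.
have: B (s *: z' + y) (s *: z' + y) <= 0.
  apply: (hyperbolic_orth_le0 hB x0).
  by rewrite bilinearPr // xz' xy mulr0 addr0.
rewrite bilinear_sqr // yy addr0 (sB z' y) => H.
have : 0 < s ^+ 2 * B z' z' + 2 * s * B y z'.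
  have -> : s ^+ 2 * B z' z' + 2 * s * B y z'
     = (B y z' / (1 - B z' z')) ^+ 2 * (2 - B z' z').
    by rewrite /s; field; rewrite gt_eqF.
  apply: mulr_gt0; last by lra.
  by rewrite lt0r sqr_ge0 sqrf_eq0 mulf_neq0 // invr_eq0 gt_eqF.
by rewrite ltNge H.
Qed.

(* [A] and [B] stand for the slices [T a] and [T b] of a symmetric trilinear
   form. On the orthogonal of [span(a, b)] both slices are nonpositive, and the
   restriction of the sum to [span(a, b)] has nonpositive determinant. *)
Lemma hyperbolic_add A B a b : symmetric_bilinear A -> symmetric_bilinear B ->
  hyperbolic A -> hyperbolic B -> (forall v, A b v = B a v) ->
  0 <= A a a -> 0 <= A a b -> 0 < A b b -> 0 <= B b b ->
  hyperbolic (fun x y => A x y + B x y).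
Proof.
move=> bA bB hA hB ab p0 q0 r0 t0.
have [sA lA] := bA; have [sB lB] := bB.
pose H x y := A x y + B x y; rewrite -/H.
have bH : symmetric_bilinear H.
  by split=> [x y|c x y z]; rewrite /H ?lA ?lB; [rewrite sA sB | ring].
have qE : B a a = A a b by rewrite -ab sA.
have rE : B a b = A b b by rewrite ab.
have bb0 : 0 < H b b by rewrite /H; lra.
have xE : a + b = 1 *: a + b by rewrite scale1r.
have Axx : 0 < A (a + b) (a + b) by rewrite xE bilinear_sqr //; lra.
have Bxx : 0 < B (a + b) (a + b) by rewrite xE bilinear_sqr // qE rE; lra.
(* By [ab], orthogonality to [a + b] for [A] is [H]-orthogonality to [a], and for [B] it is
   [H]-orthogonality to [b]. *)
have AxE v : A (a + b) v = H a v by rewrite xE lA ab mul1r.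
have BxE v : B (a + b) v = H b v by rewrite xE lB -ab mul1r.
(* Write [p, q, r, t] for [A a a], [A a b], [A b b], [B b b]. On [span(a, b)] the Gram matrix of [H]
   has entries [p + q], [q + r], [r + t], and its determinant is nonpositive by [p r <= q ^ 2],
   [q t <= r ^ 2] and [p t <= q r]. *)
have pr : A a a * A b b <= A a b ^+ 2.
  move: p0; rewrite le_eqVlt => /orP[/eqP <-|p0]; last exact: hA.
  by rewrite mul0r sqr_ge0.
have qt : A a b * B b b <= A b b ^+ 2.
  rewrite -rE; move: t0; rewrite le_eqVlt => /orP[/eqP <-|t0].
    by rewrite mulr0 sqr_ge0.
  by rewrite -qE mulrC sB hB.
have pt : A a a * B b b <= A a b * A b b.
  move: q0; rewrite le_eqVlt => /orP[/eqP q0|q0].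
    move: pr; rewrite -q0 expr0n /= pmulr_lle0 // => pr.
    by have -> : A a a = 0 by [lra]; rewrite !mul0r.
  have := ler_pM (mulr_ge0 p0 (ltW r0)) (mulr_ge0 (ltW q0) t0) pr qt.
  rewrite -(ler_pM2l (mulr_gt0 q0 r0)).
  by move=> h; nra.
pose c := - (H a b / H b b).
pose a' := c *: b + a.
have ba' : H b a' = 0.
  by rewrite bilinearPr // (proj1 bH b a) /c mulNr divfK ?gt_eqF // addNr.
have a'a' : H a' a' <= 0.
  have : H b b * H a' a' <= 0.
    rewrite bilinear_sqr // (proj1 bH b a).
    have -> : H b b * (c ^+ 2 * H b b + 2 * c * H a b + H a a)
      = H a a * H b b - H a b ^+ 2 by rewrite /c; field; rewrite gt_eqF.
    by rewrite /H qE rE; nra.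
  by rewrite pmulr_rle0.
have aa' : H a a' = H a' a'.
  by rewrite {2}/a' (proj2 bH) ba' mulr0 add0r.
have orth v : H a v = 0 -> H b v = 0 -> A v v <= 0 /\ B v v <= 0.
  move=> av bv; split.
    by apply: (hyperbolic_orth_le0 hA Axx); rewrite AxE.
  by apply: (hyperbolic_orth_le0 hB Bxx); rewrite BxE.
have neg v : H b v = 0 -> H v v <= 0.
  (* If [H a' a' = 0], then [a'] is isotropic for both [A] and [B], hence orthogonal to [v] for
     both, which makes [v] orthogonal to [a] as well. Otherwise the [a'] component of [v] can be
     split off. *)
  move=> bv; case: (eqVneq (H a' a') 0) => [z|nz].
    have [|//|Aa Ba] := orth a'; first by rewrite aa'.
    have az : A a' v = 0.
      apply: (hyperbolic_orth_isotropic _ bA hA Axx); rewrite ?AxE ?aa' //.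
      by move: z; rewrite /H; lra.
    have bz : B a' v = 0.
      apply: (hyperbolic_orth_isotropic _ bB hB Bxx); rewrite ?BxE //.
      by move: z; rewrite /H; lra.
    have a'v : H a' v = 0 by rewrite /H az bz addr0.
    have [|//|Av Bv] := orth v; last by rewrite /H; lra.
    by move: a'v; rewrite (proj2 bH) bv mulr0 add0r.
  pose d := - (H a' v / H a' a').
  pose v' := d *: a' + v.
  have bv' : H b v' = 0 by rewrite bilinearPr // ba' bv mulr0 addr0.
  have a'v' : H a' v' = 0.
    by rewrite bilinearPr // /d mulNr divfK // addNr.
  have av' : H a v' = 0.
    by move: a'v'; rewrite {1}/a' (proj2 bH) bv' mulr0 add0r.
  have [Av Bv] := orth v' av' bv'.
  have vE : v = (- d) *: a' + v' by rewrite /v' addrA -scalerDl addNr scale0r add0r.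
  rewrite {1 2}vE bilinear_sqr // a'v' mulr0 addr0.
  have : H v' v' <= 0 by rewrite /H; lra.
  have : (- d) ^+ 2 * H a' a' <= 0 by rewrite nmulr_lle0 ?sqr_ge0 // lt_neqAle nz.
  lra.
apply: (@hyperbolic_of_one H b) => // y.
pose y' := (- (H b y / H b b)) *: b + y.
have by' : H b y' = 0.
  by rewrite bilinearPr // mulNr divfK ?gt_eqF // addNr.
have := neg y' by'; rewrite bilinear_sqr // -(ler_pM2l bb0) mulr0.
have -> : H b b * ((- (H b y / H b b)) ^+ 2 * H b b
   + 2 * - (H b y / H b b) * H b y + H y y) = H b b * H y y - H b y ^+ 2.
  by field; rewrite gt_eqF.
by rewrite subr_le0.
Qed.

(* The reversed Cauchy-Schwarz inequality at [o], for forms which are allowed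
   to vanish identically. *)
Definition lorentzian_form (o : V) B : Prop :=
  [/\ 0 <= B o o, B o o = 0 -> forall x y, B x y = 0
    & forall y, B o o * B y y <= B o y ^+ 2].

Lemma lorentzian_form_hyperbolic o B : symmetric_bilinear B ->
  lorentzian_form o B -> hyperbolic B.
Proof.
move=> bB [o0 oz H]; case: (eqVneq (B o o) 0) => [z|nz].
  by move=> x y; rewrite oz ?ltxx.
by apply: (hyperbolic_of_one bB _ H); rewrite lt0r nz.
Qed.

Lemma eq_lorentzian_form o A B : (forall x y, A x y = B x y) ->
  lorentzian_form o A -> lorentzian_form o B.
Proof.
move=> AB [o0 oz H]; split=> [|z x y|y]; rewrite -!AB //.
by apply: oz; rewrite AB.
Qed.

(** Stands in for letting [e] tend to 0 over an arbitrary ordered field. *)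
Lemma poly2_limit_ge0 (a b c : R) :
  (forall e, 0 < e -> 0 <= a + b * e + c * e ^+ 2) -> 0 <= a.
Proof.
move=> H; rewrite leNgt; apply/negP => a0.
pose m := `|b| + `|c| + 1.
have m0 : 0 < m by rewrite /m ltr_wpDl // addr_ge0.
have b0 := normr_ge0 b; have c0 := normr_ge0 c.
(* Chosen so that [e <= 1], hence [e ^ 2 <= e], and [m * e < - a]; the polynomial is then negative
   at [e]. *)
pose e := - a / (m * (1 - a)).
have d0 : 0 < m * (1 - a) by apply: mulr_gt0 => //; lra.
have e0 : 0 < e by apply: divr_gt0 => //; lra.
have e1 : e <= 1.
  rewrite ler_pdivrMr // mul1r.
  have : 1 * (1 - a) <= m * (1 - a) by apply: ler_wpM2r; rewrite /m; lra.
  lra.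
have me : m * e < - a.
  have -> : m * e = - a / (1 - a) by rewrite /e; field; rewrite (gt_eqF m0) /=; lra.
  by rewrite ltr_pdivrMr; [nra | lra].
have := H e e0.
have h1 : b * e <= `|b| * e by rewrite ler_wpM2r ?ler_norm ?ltW.
have h2 : c * e ^+ 2 <= `|c| * e.
  apply: (@le_trans _ _ (`|c| * e ^+ 2)).
    by rewrite ler_wpM2r ?ler_norm ?sqr_ge0.
  by apply: ler_wpM2l => //; rewrite expr2 ler_piMl // ltW.
by move: me; rewrite /m; nra.
Qed.

Definition symmetric_trilinear (T : V -> V -> V -> R) : Prop :=
  [/\ forall x y z, T x y z = T y x z, forall x y z, T x y z = T x z y
    & forall c x y z w, T (c *: x + y) z w = c * T x z w + T y z w].

Lemma symmetric_trilinear_slice T x :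
  symmetric_trilinear T -> symmetric_bilinear (T x).
Proof.
case=> s1 s2 l; split=> [y z|c y z w]; first exact: s2.
by rewrite s1 l !(s1 _ x).
Qed.

(** * Slices of a symmetric trilinear form along a convex cone *)

Section Cone.
Variables (T : V -> V -> V -> R) (C : V -> Prop) (o : V).
Hypothesis T_tri : symmetric_trilinear T.
Hypothesis C0 : C 0.
Hypothesis C_lin : forall c x y, 0 <= c -> C x -> C y -> C (c *: x + y).
Hypothesis T_ge0 : forall x y z, C x -> C y -> C z -> 0 <= T x y z.
Hypothesis Co : C o.

Let s12 x y z : T x y z = T y x z. Proof. by case: T_tri. Qed.
Let s23 x y z : T x y z = T x z y. Proof. by case: T_tri. Qed.
Let lT c x y z w : T (c *: x + y) z w = c * T x z w + T y z w.
Proof. by case: T_tri. Qed.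
Let bT x : symmetric_bilinear (T x). Proof. exact: symmetric_trilinear_slice. Qed.

Lemma trilinearZ c x y z : T (c *: x) y z = c * T x y z.
Proof. by rewrite s12 s23 (bilinearZr _ _ _ (bT y)) -s23 s12. Qed.

Lemma trilinearD x y z w : T (x + y) z w = T x z w + T y z w.
Proof. by rewrite -[x]scale1r lT mul1r scale1r. Qed.

Lemma hyperbolic_sliceD a b : C a -> C b -> hyperbolic (T a) ->
  hyperbolic (T b) -> 0 < T a b b -> hyperbolic (T (a + b)).
Proof.
move=> Ca Cb Ha Hb abb x y.
rewrite !trilinearD; apply: (@hyperbolic_add _ _ a b) => //; try exact: T_ge0.
Qed.

Lemma hyperbolic_sliceZ c a : 0 <= c -> hyperbolic (T a) ->
  hyperbolic (T (c *: a)).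
Proof.
move=> c0 Ha x y; rewrite !trilinearZ.
move: c0; rewrite le_eqVlt => /orP[/eqP <-|c0]; first by rewrite mul0r ltxx.
rewrite pmulr_rgt0 // => /Ha H; rewrite exprMn mulrACA -expr2.
by apply: ler_wpM2l => //; exact: sqr_ge0.
Qed.

Lemma lorentzian_sliceZ c a : 0 <= c -> lorentzian_form o (T a) ->
  lorentzian_form o (T (c *: a)).
Proof.
move=> c0 [o0 oz H]; split=> [|z x y|y]; rewrite ?trilinearZ ?mulr_ge0 //.
  move: z; rewrite trilinearZ => /eqP; rewrite mulf_eq0 => /orP[/eqP ->|/eqP z].
    by rewrite mul0r.
  by rewrite oz ?mulr0.
by rewrite exprMn mulrACA -expr2; apply: ler_wpM2l => //; exact: sqr_ge0.
Qed.

(* [T (a + e *: o)] and [T (b + e *: o)] are positive enough for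
   [hyperbolic_sliceD], and the inequality survives [e -> 0]. *)
Lemma lorentzian_sliceD a b : C a -> C b -> lorentzian_form o (T o) ->
  lorentzian_form o (T a) -> lorentzian_form o (T b) ->
  lorentzian_form o (T (a + b)).
Proof.
move=> Ca Cb Lo La Lb.
have Ho := lorentzian_form_hyperbolic (bT o) Lo.
have Ha := lorentzian_form_hyperbolic (bT a) La.
have Hb := lorentzian_form_hyperbolic (bT b) Lb.
case: (La) => a0 az _; case: (Lb) => b0 bz _; case: (Lo) => _ oz _.
(* A slice with value 0 at [o] vanishes identically, which leaves only the other summand. *)
have [aoo|aoo] := eqVneq (T a o o) 0.
  by apply: eq_lorentzian_form Lb => x y; rewrite trilinearD az ?add0r.
have [boo|boo] := eqVneq (T b o o) 0.
  by apply: eq_lorentzian_form La => x y; rewrite trilinearD bz ?addr0.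
have a0' : 0 < T a o o by rewrite lt0r aoo.
have b0' : 0 < T b o o by rewrite lt0r boo.
have o0 : 0 < T o o o.
  rewrite lt0r T_ge0 // andbT; apply: contraNneq aoo => z.
  by rewrite s12 oz.
split=> [|z|y]; first by rewrite trilinearD addr_ge0 // ltW.
  by move: z; rewrite trilinearD => z; exfalso; lra.
pose N u v := T (a + b) u v.
(* The inequality for the slice at [(e *: o + a) + (e *: o + b)]: a polynomial in [e] whose constant
   term is the claim. *)
have key e : 0 < e -> 0 <= (N o y + 2 * e * T o o y) ^+ 2
    - (N o o + 2 * e * T o o o) * (N y y + 2 * e * T o y y).
  move=> e0; have e0' := ltW e0.
  have Ceo x : C x -> C (e *: o + x) by move=> Cx; apply: C_lin.
  have Ce : C (e *: o) by rewrite -[e *: o]addr0; apply: Ceo.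
  have Heo x : C x -> hyperbolic (T x) -> 0 < T x o o ->
      hyperbolic (T (e *: o + x)).
    move=> Cx Hx x0; rewrite addrC; apply: hyperbolic_sliceD => //.
      exact: hyperbolic_sliceZ.
    by rewrite (bilinearZr _ _ _ (bT x)) s23 (bilinearZr _ _ _ (bT x)) !mulr_gt0.
  have pos : 0 < T (e *: o + a) (e *: o + b) (e *: o + b).
    rewrite lT; apply: ltr_pwDl; last by apply: T_ge0 => //; exact: Ceo.
    rewrite pmulr_rgt0 // (bilinear_sqr _ _ _ (bT o)).
    have h1 := T_ge0 Co Co Cb; have h2 := T_ge0 Co Cb Cb.
    have : 0 < e ^+ 2 * T o o o by rewrite mulr_gt0 // exprn_gt0.
    have : 0 <= 2 * e * T o o b by rewrite !mulr_ge0.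
    lra.
  have E u v : T ((e *: o + a) + (e *: o + b)) u v = N u v + 2 * e * T o u v.
    by rewrite /N !trilinearD !trilinearZ; ring.
  have/(_ o y) := hyperbolic_sliceD (Ceo a Ca) (Ceo b Cb) (Heo a Ca Ha a0')
    (Heo b Cb Hb b0') pos.
  rewrite !E subr_ge0; apply.
  by rewrite ltr_wpDl ?mulr_gt0 // /N trilinearD addr_ge0 // ltW.
have := @poly2_limit_ge0 (N o y ^+ 2 - N o o * N y y)
  (2 * (2 * N o y * T o o y - N o o * T o y y - T o o o * N y y))
  (4 * (T o o y ^+ 2 - T o o o * T o y y)).
rewrite subr_ge0; apply=> e e0.
by have := key e e0; set z := (X in _ <= X -> _) => Hz; apply: (le_trans Hz);
  rewrite le_eqVlt; apply/orP; left; apply/eqP; rewrite /z; ring.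
Qed.

End Cone.
End Forms.

(** * Lorentzian tensors *)

(* A homogeneous polynomial is encoded by its iterated partial derivatives of
   maximal order: [t [:: i1; i2; i3]] is the coefficient of the derivative along
   [i1], [i2], [i3], and [deriv x] is the derivative along the vector [x]. *)
Section Tensors.
Variables (R : realFieldType) (I : finType).
Implicit Types (t : seq I -> R) (s : seq I).
Local Notation vec := {ffun I -> R^o}.
Implicit Types (x y z : vec) (L : seq vec).

Definition symmetric_tensor t := forall s s', perm_eq s s' -> t s = t s'.

Definition deriv x t : seq I -> R := fun s => \sum_i (x i : R) * t (i :: s).

Definition delta (k : I) : vec := [ffun i => (i == k)%:R].

Definition nonneg_vec x : Prop := forall i, 0 <= (x i : R).

Lemma eq_deriv x t t' : t =1 t' -> deriv x t =1 deriv x t'.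
Proof. by move=> tt' s; apply: eq_bigr => i _; rewrite tt'. Qed.

Lemma symmetric_deriv x t : symmetric_tensor t -> symmetric_tensor (deriv x t).
Proof.
move=> st s s' ss'; apply: eq_bigr => i _; congr (_ * _); apply: st.
by rewrite perm_cons.
Qed.

Lemma derivC x y t : symmetric_tensor t ->
  deriv x (deriv y t) =1 deriv y (deriv x t).
Proof.
move=> st s; rewrite /deriv.
under eq_bigr do rewrite mulr_sumr.
rewrite exchange_big; apply: eq_bigr => j _; rewrite mulr_sumr.
apply: eq_bigr => i _; rewrite mulrCA; congr (_ * (_ * _)); apply: st.
by rewrite (perm_catCA [:: j] [:: i] s).
Qed.

Lemma deriv_lin c x y t s :
  deriv (c *: x + y) t s = c * deriv x t s + deriv y t s.
Proof.
rewrite /deriv mulr_sumr -big_split; apply: eq_bigr => i _ /=.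
by rewrite !ffunE mulrDl mulrA.
Qed.

Lemma deriv_delta k t s : deriv (delta k) t s = t (k :: s).
Proof.
rewrite /deriv (bigD1 k) //= ffunE eqxx mul1r big1 ?addr0 // => i /negPf ik.
by rewrite ffunE ik mul0r.
Qed.

Lemma deriv_ge0 x t : nonneg_vec x -> (forall s, 0 <= t s) ->
  forall s, 0 <= deriv x t s.
Proof. by move=> x0 t0 s; apply: sumr_ge0 => i _; rewrite mulr_ge0. Qed.

Lemma nonneg_delta k : nonneg_vec (delta k).
Proof. by move=> i; rewrite ffunE ler0n. Qed.

Lemma nonneg_vecD c x y : 0 <= c -> nonneg_vec x -> nonneg_vec y ->
  nonneg_vec (c *: x + y).
Proof. by move=> c0 x0 y0 i; rewrite !ffunE addr_ge0 // mulr_ge0. Qed.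

Lemma nonneg_vec0 : nonneg_vec 0.
Proof. by move=> i; rewrite ffunE. Qed.

Lemma vec_sum_delta x : x = \sum_i (x i : R) *: delta i.
Proof.
apply/ffunP => j; rewrite sum_ffunE (bigD1 j) //= !ffunE eqxx.
rewrite big1 ?addr0 => [|i ij]; first by rewrite [RHS]mulr1.
by rewrite !ffunE eq_sym (negPf ij) [LHS]mulr0.
Qed.

(** The degree is [m + 2]: [m] coordinate derivatives leave a quadratic form. Only coordinate
    derivatives are tested, which can be checked by hand; [lorentzian_deriv] reaches all nonnegative
    directions. *)
Definition lorentzian (o : I) m t : Prop := forall s, size s = m ->
  lorentzian_form (delta o) (fun x y => deriv x (deriv y t) s).

(** The trilinear form [T] left by the derivatives [s] has Lorentzian slices at the coordinate
    vectors. Since [x] is a nonnegative combination of those, [lorentzian_sliceZ] and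
    [lorentzian_sliceD] give the slice at [x]. *)
Lemma lorentzian_deriv o m x t : symmetric_tensor t -> (forall s, 0 <= t s) ->
  nonneg_vec x -> lorentzian o m.+1 t -> lorentzian o m (deriv x t).
Proof.
move=> st t0 x0 Lt s sm.
pose T z y w := deriv y (deriv w (deriv z t)) s.
have sd y := symmetric_deriv y st.
have Tl : symmetric_trilinear T.
  split=> [y z w|y z w|c y z w u]; rewrite /T.
  - have E a : deriv w (deriv a t) =1 deriv a (deriv w t) by exact: derivC.
    by rewrite (eq_deriv _ (E y)) derivC // (eq_deriv _ (E z)).
  - by rewrite derivC.
  have E a : deriv w (deriv u (deriv a t)) s = deriv a (deriv w (deriv u t)) s.
    by rewrite (eq_deriv w (derivC u a st)) derivC.
  by rewrite !E deriv_lin.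
have T0 y z w : nonneg_vec y -> nonneg_vec z -> nonneg_vec w -> 0 <= T y z w.
  by move=> y0 z0 w0; do 3![apply: deriv_ge0 => //].
have Td k : lorentzian_form (delta o) (T (delta k)).
  have := Lt (k :: s); rewrite /= sm => /(_ erefl); apply: eq_lorentzian_form.
  move=> y z; rewrite /T.
  have E1 := derivC z (delta k) st.
  rewrite [RHS](eq_deriv y E1) [RHS]derivC ?deriv_delta //; exact: symmetric_deriv.
suff [] : nonneg_vec x /\ lorentzian_form (delta o) (T x) by [].
have lin := nonneg_vecD; have n0 := nonneg_vec0; have nd := nonneg_delta.
have z0 : lorentzian_form (delta o) (T 0).
  have := lorentzian_sliceZ Tl (lexx 0) (Td o).
  by rewrite scale0r.
rewrite (vec_sum_delta x); elim/big_rec: _ => [|i y _ [y0 Ly]]; first by split.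
split; first exact: nonneg_vecD.
have := @lorentzian_sliceD _ _ T nonneg_vec (delta o) Tl n0.
apply=> //.
- by rewrite -[_ *: _]addr0; exact: nonneg_vecD.
exact: lorentzian_sliceZ.
Qed.

Lemma derivs_symmetric t L : symmetric_tensor t ->
  symmetric_tensor (foldr deriv t L).
Proof. by move=> st; elim: L => //= x L IH; exact: symmetric_deriv. Qed.

Lemma derivs_ge0 t L : (forall x, x \in L -> nonneg_vec x) ->
  (forall s, 0 <= t s) -> forall s, 0 <= foldr deriv t L s.
Proof.
elim: L => //= x L IH L0 t0; apply: deriv_ge0; first by apply: L0; rewrite inE eqxx.
by apply: IH => // y yL; apply: L0; rewrite inE yL orbT.
Qed.

Lemma derivs_lorentzian o m t L : symmetric_tensor t -> (forall s, 0 <= t s) ->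
  (forall x, x \in L -> nonneg_vec x) -> lorentzian o (size L + m) t ->
  lorentzian o m (foldr deriv t L).
Proof.
move=> st t0; elim: L m => //= x L IH m L0 Lt.
have L0' y : y \in L -> nonneg_vec y by move=> yL; apply: L0; rewrite inE yL orbT.
apply: lorentzian_deriv; first exact: derivs_symmetric.
- exact: derivs_ge0.
- by apply: L0; rewrite inE eqxx.
by apply: IH => //; rewrite addnS.
Qed.

Lemma eq_derivs t t' L : t =1 t' -> foldr deriv t L =1 foldr deriv t' L.
Proof. by move=> tt'; elim: L => //= x L IH; exact: eq_deriv. Qed.

Lemma deriv_derivs x t L : symmetric_tensor t ->
  foldr deriv (deriv x t) L =1 deriv x (foldr deriv t L).
Proof.
move=> st; elim: L => //= y L IH s; rewrite (eq_deriv y IH) derivC //.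
exact: derivs_symmetric.
Qed.

Lemma derivs_catC t L L' : symmetric_tensor t ->
  foldr deriv t (L ++ L') =1 foldr deriv t (L' ++ L).
Proof.
move=> st; elim: L => [|x L IH] s; first by rewrite cats0.
rewrite /= (eq_deriv x IH) !foldr_cat -deriv_derivs //.
exact: derivs_symmetric.
Qed.

Lemma derivs_perm t L L' : symmetric_tensor t -> perm_eq L L' ->
  foldr deriv t L =1 foldr deriv t L'.
Proof.
move=> st LL'.
apply: (catCA_perm_ind (P := fun L0 => foldr deriv t L =1 foldr deriv t L0)) LL' _ => //.
move=> L1 L2 L3 E s; rewrite {}E !catA ![foldr _ _ (_ ++ L3)]foldr_cat.
by apply: derivs_catC; exact: derivs_symmetric.
Qed.

End Tensors.
Arguments deriv {R I} x t s.

(** * Multi-affine part of a linear substitution *)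

Section MultiAffine.
Variables (R : realFieldType) (I J : finType).
Local Notation vec T := {ffun T -> R^o}.

Lemma deriv_sum (K : Type) (r : seq K) (P : pred K) (c : K -> R) (a : K -> vec I)
    t s :
  deriv (\sum_(k <- r | P k) c k *: a k) t s
  = \sum_(k <- r | P k) c k * deriv (a k) t s.
Proof.
elim/big_rec2: _ => [|k x y _ <-]; last by rewrite deriv_lin.
by rewrite /deriv big1 // => i _; rewrite ffunE mul0r.
Qed.

Variables (o : I) (v : J -> vec I) (t : seq I -> R).

Definition subst_vec (i : option J) : vec I :=
  if i is Some j then v j else delta R o.

(* The multi-affine part in the variables [y j] of the polynomial [t] evaluated
   at [y None *: delta o + \sum_j y j *: v j]. *)
Definition multiaffine (s : seq (option J)) : R :=
  if uniq (pmap id s) then foldr deriv t (map subst_vec s) [::] else 0.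

Hypothesis (t_sym : symmetric_tensor t) (t_ge0 : forall s, 0 <= t s).
Hypothesis v_ge0 : forall j, nonneg_vec (v j).

Lemma subst_vec_ge0 i : nonneg_vec (subst_vec i).
Proof. by case: i => [j|] /=; [exact: v_ge0 | exact: nonneg_delta]. Qed.

Lemma multiaffine_ge0 s : 0 <= multiaffine s.
Proof.
rewrite /multiaffine; case: ifP => // _; apply: derivs_ge0 => // x.
by case/mapP => i _ ->; exact: subst_vec_ge0.
Qed.

Lemma symmetric_multiaffine : symmetric_tensor multiaffine.
Proof.
move=> s s' ss'; rewrite /multiaffine.
have -> : uniq (pmap id s) = uniq (pmap id s') by apply/perm_uniq/perm_pmap.
by case: ifP => // _; apply: derivs_perm => //; exact: perm_map.
Qed.

(** The form at [s] is the pullback of [q] along [hat] minus a diagonal form with weights [d >= 0].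
    As [d None = 0], the subtraction leaves every pairing with [delta R None] unchanged and can only
    lower the value at [(y, y)]. *)
Lemma lorentzian_multiaffine m :
  lorentzian o m t -> lorentzian None m multiaffine.
Proof.
move=> Lt s sm.
case us : (uniq (pmap id s)); last first.
  apply: (@eq_lorentzian_form _ _ _ (fun _ _ => 0)).
    move=> x y; rewrite /deriv big1 // => i _; rewrite big1 ?mulr0 // => j _.
    rewrite /multiaffine /=.
    by case: i j => [i|] [j|] /=; rewrite us ?andbF ?mulr0.
  by split=> // y; rewrite mul0r expr0n.
pose w := foldr deriv t (map subst_vec s).
have w_sym : symmetric_tensor w by exact: derivs_symmetric.
have w0 : forall r, 0 <= w r.
  apply: derivs_ge0 => // x; case/mapP => i _ ->; exact: subst_vec_ge0.
pose q y z := deriv y (deriv z w) [::].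
have qC y z : q y z = q z y by rewrite /q derivC.
have [q0 qz qH] : lorentzian_form (delta R o) q.
  apply: (@derivs_lorentzian _ _ o 0) => //; last by rewrite size_map sm addn0.
  move=> x; case/mapP => i _ ->; exact: subst_vec_ge0.
(* [ok] rules out the variables already used in [s], along which a further derivative is zero; [d]
   records the square terms to be removed. *)
pose ok (i : option J) := if i is Some j then j \notin pmap id s else true.
pose hat (x : vec (option J)) := \sum_(i | ok i) (x i : R) *: subst_vec i.
pose d (i : option J) : R := if i is Some j then q (v j) (v j) else 0.
have d0 i : 0 <= d i.
  by case: i => //= j; do 2![apply: deriv_ge0 => //].
have uE i j : multiaffine (j :: i :: s) = (if ok i && ok j then
    q (subst_vec i) (subst_vec j) - (i == j)%:R * d i else 0).
  rewrite /multiaffine /= -/w [X in if _ then X else _]qC.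
  case: i j => [i|] [j|] /=; rewrite us ?andbT ?mulr0 ?mul0r ?subr0 //.
  have -> : (Some i == Some j) = (i == j) by [].
  rewrite in_cons negb_or; case: (eqVneq i j) => [->|ij].
    by rewrite mul1r subrr if_same.
  by rewrite mul0r subr0 andbC.
have BE x y : deriv x (deriv y multiaffine) s
    = q (hat x) (hat y) - \sum_(i | ok i) (x i : R) * (y i : R) * d i.
  have -> : q (hat x) (hat y) = \sum_(i | ok i) (x i : R) *
      \sum_(j | ok j) (y j : R) * q (subst_vec i) (subst_vec j).
    rewrite /q deriv_sum; apply: eq_bigr => i _; congr (_ * _).
    by rewrite derivC // deriv_sum; apply: eq_bigr => j _; rewrite -derivC.
  rewrite -sumrB {1}/deriv [RHS]big_mkcond; apply: eq_bigr => i _ /=.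
  have -> : deriv y multiaffine (i :: s) = \sum_j (y j : R) * (if ok i && ok j
      then q (subst_vec i) (subst_vec j) - (i == j)%:R * d i else 0).
    by apply: eq_bigr => j _; rewrite -uE.
  case oki: (ok i) => /=; last first.
    by rewrite big1 ?mulr0 // => j _; rewrite mulr0.
  rewrite -mulrA -mulrBr; congr (_ * _).
  under eq_bigr do rewrite fun_if mulr0 mulrBr.
  rewrite -big_mkcond sumrB; congr (_ - _).
  rewrite (bigD1 i) //= eqxx mul1r big1 ?addr0 // => j /andP[_ ij].
  by rewrite eq_sym (negPf ij) mul0r mulr0.
have hatN : hat (delta R None) = delta R o.
  rewrite /hat (bigD1 None) //= ffunE eqxx scale1r big1 ?addr0 // => i /andP[_ iN].
  by rewrite ffunE (negPf iN) scale0r.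
have BN y : deriv (delta R None) (deriv y multiaffine) s = q (delta R o) (hat y).
  rewrite BE hatN big1 ?subr0 // => i _; rewrite ffunE.
  by case: i => [j|] /=; rewrite ?mul0r // mulr0.
split=> [|z x y|y]; first by rewrite BN hatN.
  have {}z := qz (etrans (esym (etrans (BN _) (congr1 _ hatN))) z).
  rewrite BE z big1 ?subrr // => i _.
  by case: i => [j|] /=; rewrite ?z mulr0.
rewrite !BN hatN BE; apply: le_trans (qH (hat y)); apply: ler_wpM2l => //.
rewrite gerBl; apply: sumr_ge0 => i _.
by rewrite mulr_ge0 // -expr2 sqr_ge0.
Qed.

End MultiAffine.

(** * Matroids *)

Section Matroids.
Variables (E : finType) (BM : {set {set E}}).
Implicit Types (A B I J : {set E}).

Definition base_exchange : Prop := forall B1 B2, B1 \in BM -> B2 \in BM ->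
  forall x, x \in B1 :\: B2 ->
    exists2 y, y \in B2 :\: B1 & (B1 :\ x) :|: [set y] \in BM.

Definition independent I : bool := [exists B in BM, I \subset B].

Lemma independentP I :
  reflect (exists2 B, B \in BM & I \subset B) (independent I).
Proof. exact: exists_inP. Qed.

Lemma independentS I J : I \subset J -> independent J -> independent I.
Proof.
move=> IJ /independentP[B BB JB]; apply/independentP; exists B => //.
exact: subset_trans JB.
Qed.

Hypothesis exch : base_exchange.

Lemma card_swap B x y : x \in B -> y \notin B -> #|(B :\ x) :|: [set y]| = #|B|.
Proof.
move=> xB yB; rewrite setUC cardsU1 !inE (negPf yB) andbF /=.
by rewrite (cardsD1 x B) xB.
Qed.

(** An exchange keeps the size of [B1] and shrinks [B1 :\: B2]. Once that is empty, an element of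
    [B2 :\: B1] would have nothing to be exchanged for. *)
Lemma card_base B1 B2 : B1 \in BM -> B2 \in BM -> #|B1| = #|B2|.
Proof.
have [m] := ubnP #|B1 :\: B2|; elim: m B1 => // m IH B1 lt_m b1 b2.
have [D0|[x xD]] := set_0Vmem (B1 :\: B2).
  have s12 : B1 \subset B2 by rewrite -setD_eq0 D0.
  have [D0'|[y yD]] := set_0Vmem (B2 :\: B1).
    by congr #|pred_of_set _|; apply/eqP; rewrite eqEsubset s12 -setD_eq0 D0' eqxx.
  by have [z] := exch b2 b1 yD; rewrite D0 inE.
have [y yD b1'] := exch b1 b2 xD.
move: (xD) (yD); rewrite !inE => /andP[x2 x1] /andP[y1 y2].
rewrite -(card_swap x1 y1); apply: IH => //.
rewrite -ltnS; apply: leq_trans lt_m; rewrite ltnS.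
apply: proper_card; apply/properP; split; last first.
  by exists x => //; rewrite !inE eqxx /= (negPf x2) /=; apply: contraNN y1 => /eqP <-.
apply/subsetP => z; rewrite !inE => /andP[z2 /orP[/andP[_ ->]|/eqP zy]].
  by rewrite z2.
by rewrite zy y2 in z2.
Qed.

(** Among the bases containing [I], take one meeting [B] in as many elements as possible: an element
    outside [I :|: B] could be exchanged for one of [B]. *)
Lemma base_extend I B : independent I -> B \in BM ->
  exists B', [/\ B' \in BM, I \subset B' & B' \subset I :|: B].
Proof.
case/independentP => B0 b0 I0 b.
pose P B' := (B' \in BM) && (I \subset B').
have P0 : P B0 by rewrite /P b0.
case: (@arg_maxnP _ B0 P (fun B' => #|B' :&: B|) P0) => B' /andP[b' IB'] maxB'.
exists B'; split=> //; apply/subsetP => z zB'; rewrite inE.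
apply/negPn/negP; rewrite negb_or => /andP[zI zB].
have [|y yD bn] := exch b' b (x := z); first by rewrite inE zB zB'.
move: yD; rewrite !inE => /andP[yB' yB].
have : P ((B' :\ z) :|: [set y]).
  rewrite /P bn /=; apply/subsetP => u uI; rewrite !inE (subsetP IB') // andbT.
  by rewrite (contraNneq _ zI) // => <-.
move/maxB' => /=; rewrite leqNgt => /negP; apply; apply: proper_card.
apply/properP; split; last by exists y; rewrite !inE ?eqxx ?orbT ?yB // (negPf yB').
apply/subsetP => u; rewrite !inE => /andP[uB' uB]; rewrite uB' uB andbT.
by rewrite (contraNneq _ zB) // => <-.
Qed.

(** Extend [x |: (B1 :&: B2)], independent inside [B2], by elements of [B1]. Equal cardinality of
    bases leaves exactly one [y] of [B1] out. *)
Lemma base_exchange_dual B1 B2 x : B1 \in BM -> B2 \in BM ->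
  x \in B2 :\: B1 -> exists2 y, y \in B1 :\: B2 & x |: (B1 :\ y) \in BM.
Proof.
move=> b1 b2; rewrite inE => /andP[x1 x2].
have [|B' [b' sI sU]] := @base_extend (x |: (B1 :&: B2)) B1 _ b1.
  apply/independentP; exists B2 => //; rewrite subUset sub1set x2.
  exact: subsetIr.
have xB' : x \in B' by apply: (subsetP sI); rewrite !inE eqxx.
have [y y1 yB'] : exists2 y, y \in B1 & y \notin B'.
  apply/subsetPn; apply: contraNN x1 => s1.
  by have /eqP -> : B1 == B' by rewrite eqEcard s1 (card_base b' b1) leqnn.
exists y.
  rewrite inE y1 andbT; apply: contraNN yB' => y2; apply: (subsetP sI).
  by rewrite !inE y1 y2 orbT.
suff /eqP <- : B' == x |: (B1 :\ y) by [].
rewrite eqEcard; apply/andP; split.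
  apply/subsetP => z zB'; have := subsetP sU z zB'; rewrite !inE.
  case/orP => [/orP[->//|/andP[z1 _]]|z1]; rewrite z1 andbT.
    by rewrite (contraNneq _ yB') ?orbT // => <-.
  by rewrite (contraNneq _ yB') ?orbT // => <-.
by rewrite setUC card_swap // (card_base b' b1).
Qed.

(** Extend [I] by elements of a base [B] containing [J]. If no element of [J :\: I] were used, the
    new base would lie in [I :|: (B :\: J)], which is smaller than [B]. *)
Lemma independent_augment I J : independent I -> independent J ->
  (#|I| < #|J|)%N -> exists2 x, x \in J :\: I & independent (x |: I).
Proof.
move=> iI /independentP[B b JB] ltIJ.
have [B' [b' sI sU]] := base_extend iI b.
have [D0|[x]] := set_0Vmem (B' :&: (J :\: I)); last first.
  rewrite inE => /andP[xB' xJ]; exists x => //; apply/independentP.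
  by exists B' => //; rewrite subUset sub1set xB'.
have : (#|B'| <= #|I :|: (B :\: J)|)%N.
  apply: subset_leq_card; apply/subsetP => z zB'.
  have := subsetP sU z zB'; rewrite !inE; case: (boolP (z \in I)) => //= zI zB.
  rewrite zB andbT; apply/negP => zJ.
  by have := in_set0 z; rewrite -D0 !inE zB' zI zJ.
have := leq_card_setU I (B :\: J); rewrite cardsD (setIidPr JB).
move=> /[swap] h1 /(leq_trans h1); rewrite (card_base b' b).
have := subset_leq_card JB; lia.
Qed.

End Matroids.

(** * Cauchy-Schwarz over the classes of an equivalence relation *)

Section ParallelClasses.
Variables (R : realFieldType) (E : finType).

Lemma sqr_sum_le (J : {set E}) (Y : E -> R) :
  (\sum_(g in J) Y g) ^+ 2 <= #|J|%:R * \sum_(g in J) Y g ^+ 2.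
Proof.
have : 0 <= \sum_(g in J) \sum_(h in J) (Y g - Y h) ^+ 2.
  by do 2![apply: sumr_ge0 => ? _]; exact: sqr_ge0.
have -> : \sum_(g in J) \sum_(h in J) (Y g - Y h) ^+ 2
  = 2 * (#|J|%:R * \sum_(g in J) Y g ^+ 2 - (\sum_(g in J) Y g) ^+ 2).
  pose S := \sum_(g in J) Y g; pose Q := \sum_(g in J) Y g ^+ 2.
  transitivity (\sum_(g in J) (#|J|%:R * Y g ^+ 2 - 2 * S * Y g + Q)).
    apply: eq_bigr => g _; rewrite -/S -/Q.
    have -> : \sum_(h in J) (Y g - Y h) ^+ 2
        = \sum_(h in J) (Y g ^+ 2 - 2 * Y g * Y h + Y h ^+ 2).
      by apply: eq_bigr => h _; ring.
    by rewrite big_split /= sumrB sumr_const -mulr_sumr -/S -/Q -mulr_natl; ring.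
  rewrite big_split /= sumrB -!mulr_sumr -/S -/Q sumr_const -mulr_natl; ring.
by rewrite pmulr_rge0 // subr_ge0.
Qed.

(** Cauchy-Schwarz for the class sums [Y], placed at class representatives and zero elsewhere; there
    are at most [#|J|] classes. *)
Lemma sqr_sum_le_classes (J : {set E}) (par : rel E) (y : E -> R) :
  {in J, forall e, par e e} -> {in J &, symmetric par} ->
  {in J & &, transitive par} ->
  (\sum_(e in J) y e) ^+ 2
    <= #|J|%:R * \sum_(e in J) \sum_(f in J | par e f) y e * y f.
Proof.
move=> rP sP tP.
(* Equivalent elements give the same predicate to [pick], so this choice is constant on each
   class. *)
pose r e := odflt e [pick g in J | par e g].
have rE e : e \in J -> r e \in J /\ par e (r e).
  move=> eJ; rewrite /r; case: pickP => [g /andP[gJ eg]|/(_ e)] //=.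
  by rewrite eJ rP.
have rP' e f : e \in J -> f \in J -> (r e == r f) = par e f.
  move=> eJ fJ; have [reJ re] := rE e eJ; have [rfJ rf] := rE f fJ.
  apply/eqP/idP => [ref|ef].
    by apply: (tP (r e)) => //; rewrite ref sP.
  rewrite /r; have -> : [pick g in J | par e g] = [pick g in J | par f g].
    apply: eq_pick => g /=; case gJ: (g \in J) => //=.
    by apply/idP/idP; [apply: tP => //; rewrite sP | apply: tP].
  case: pickP => //= /(_ f); by rewrite fJ rP.
pose Y g := \sum_(e in J | r e == g) y e.
have -> : \sum_(e in J) y e = \sum_(g in J) Y g.
  rewrite (partition_big r (mem J)) //= => e eJ; exact: (proj1 (rE e eJ)).
apply: le_trans (sqr_sum_le J Y) _; rewrite le_eqVlt; apply/orP; left; apply/eqP.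
congr (_ * _); rewrite [RHS](partition_big r (mem J)) /=; last first.
  by move=> e eJ; exact: (proj1 (rE e eJ)).
apply: eq_bigr => g gJ; rewrite expr2 mulr_suml; apply: eq_bigr => e /andP[eJ /eqP eg].
rewrite mulr_sumr; apply: eq_bigl => f; case fJ: (f \in J) => //=.
by rewrite -rP' // eg eq_sym.
Qed.

End ParallelClasses.

(** * The Lorentzian polynomial of a matroid *)

Section MatroidTensor.
Variables (R : realFieldType) (E : finType) (BM : {set {set E}}).
Hypothesis exch : base_exchange BM.
Local Notation ind := (independent BM).
Local Notation vec := {ffun option E -> R^o}.

(* The polynomial [\sum_I w_None ^ (N - #|I|) * \prod_(e in I) w_e], summed over
   the independent sets; its degree [N] is the length of the sequence [s]. *)
Definition matroid_tensor (s : seq (option E)) : R :=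
  if uniq (pmap id s) && ind [set x in pmap id s]
  then (count_mem None s)`!%:R else 0.

Lemma matroid_tensor_ge0 s : 0 <= matroid_tensor s.
Proof. by rewrite /matroid_tensor; case: ifP => // _; rewrite ler0n. Qed.

Lemma symmetric_matroid_tensor : symmetric_tensor matroid_tensor.
Proof.
move=> s s' ss'; have pp := perm_pmap id ss'; rewrite /matroid_tensor.
rewrite (perm_uniq pp) (permP ss').
have -> // : [set x in pmap id s] = [set x in pmap id s'].
by apply/setP => x; rewrite !inE (perm_mem pp).
Qed.

Lemma big_option (F : option E -> R) :
  \sum_i F i = F None + \sum_e F (Some e).
Proof.
rewrite (bigD1 None) //=; congr (_ + _).
rewrite (reindex_omap Some id) /=; last by case.
by apply: eq_bigl => e; rewrite eqxx.
Qed.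

(** Let [S] be the sum of [y] over the non-loops [J] of the contraction by [I], and [Q] its sum of
    products over non-parallel pairs. Up to a nonnegative factor the claim is
    [S ^ 2 <= (a + 2) * (S ^ 2 - Q)], where [S ^ 2 - Q] runs over parallel pairs. This is
    Cauchy-Schwarz over parallel classes, as [#|E| <= m + 2] bounds [#|J|] by [a + 2]. *)
Lemma lorentzian_matroid_tensor m : (#|E| <= m.+2)%N ->
  lorentzian None m matroid_tensor.
Proof.
move=> Em s sm; pose I := [set x in pmap id s].
case us : (uniq (pmap id s) && ind I); last first.
  have z e f : matroid_tensor [:: e, f & s] = 0.
    rewrite /matroid_tensor; case: ifP => // /andP[u i]; exfalso.
    have {u} u : uniq (pmap id s).
      by case: e f u {i} => [e|] [f|] //= ; do ?[case/andP => _].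
    move: us; rewrite u /= (independentS _ i) //.
    clear i; apply/subsetP => x; rewrite !inE.
    by case: e f => [e|] [f|] //=; rewrite ?inE => ->; rewrite ?orbT.
  apply: (@eq_lorentzian_form _ _ _ (fun _ _ => 0)).
    move=> x y; rewrite /deriv big1 // => i _; rewrite big1 ?mulr0 // => j _.
    by rewrite z mulr0.
  by split=> // y; rewrite mul0r expr0n.
case/andP: us => us iI.
pose a := count_mem None s.
have aE : (a + #|I| = m)%N.
  rewrite -sm /I cardsE (card_uniqP us) size_pmap /a -(count_predC (pred1 None) s).
  by congr addn; apply: eq_count => -[].
pose J := [set e | (e \notin I) && ind (e |: I)].
have Ja : (#|J| <= a.+2)%N.
  have : (#|I :|: J| <= #|E|)%N by exact: max_card.
  rewrite cardsU disjoint_setI0 ?cards0; first by lia.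
  by rewrite disjoint_sym disjoints_subset; apply/subsetP => e; rewrite !inE => /andP[].
pose adj e f := (e != f) && ind (f |: (e |: I)).
have adjC e f : adj e f = adj f e by rewrite /adj eq_sym setUCA.
have cJ e : e \in J -> #|e |: I| = #|I|.+1.
  by rewrite inE => /andP[eI _]; rewrite cardsU1 eI.
(* If [e] and [g] were not parallel, augmenting [f |: I] from [g |: (e |: I)] would make [f]
   non-parallel to one of them. *)
have par_trans : {in J & &, transitive (fun e f => ~~ adj e f)}.
  move=> f e g fJ eJ gJ /= ef fg; apply/negP => /andP[neg ieg].
  have fI : ind (f |: I) by move: fJ; rewrite inE => /andP[].
  have [|x] := independent_augment exch fI ieg.
    rewrite (cJ f fJ) cardsU1 (cJ e eJ) !inE negb_or eq_sym neg /=.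
    by move: gJ; rewrite !inE => /andP[-> _].
  rewrite !inE negb_or => /andP[/andP[xf xI]].
  rewrite (negPf xI) orbF => xeg h.
  have fx : adj f x by rewrite /adj eq_sym xf.
  by case/orP: xeg fx => /eqP ->; [rewrite (negPf fg) | rewrite adjC (negPf ef)].
have tNN : matroid_tensor [:: None, None & s] = (a.+2)`!%:R.
  by rewrite /matroid_tensor /= us iI.
have tNS e : matroid_tensor [:: None, Some e & s] = (e \in J)%:R * (a.+1)`!%:R.
  rewrite /matroid_tensor /= us andbT set_cons -/I -/a add0n.
  have -> : (e \in J) = (e \notin pmap id s) && ind (e |: I) by rewrite !inE.
  by case: ifP; rewrite ?mul1r ?mul0r.
have tSN e : matroid_tensor [:: Some e, None & s] = (e \in J)%:R * (a.+1)`!%:R.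
  by rewrite -tNS; apply: symmetric_matroid_tensor; rewrite (perm_catCA [:: _] [:: _] s).
have tSS e f : matroid_tensor [:: Some f, Some e & s]
    = [&& e \in J, f \in J & adj e f]%:R * a`!%:R.
  rewrite /matroid_tensor /= us andbT !set_cons -/I -/a !add0n.
  have -> : [&& e \in J, f \in J & adj e f]
     = ((f \notin e :: pmap id s) && (e \notin pmap id s)) && ind (f |: (e |: I)).
    rewrite !inE negb_or /adj [f == e]eq_sym.
    case: (e == f) => /=; rewrite ?andbF //.
    case: (e \in _) => /=; rewrite ?andbF //.
    case: (f \in _) => /=; rewrite ?andbF //.
    case i2: (ind (f |: (e |: I))); rewrite ?andbF // andbT.
    by apply/andP; split; apply: independentS i2; rewrite ?subsetU1 // setUCA subsetU1.
  by case: ifP; rewrite ?mul1r ?mul0r.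
pose S (y : vec) : R := \sum_(e in J) (y (Some e) : R).
have BN y : deriv (delta R None) (deriv y matroid_tensor) s
    = (a.+2)`!%:R * y None + (a.+1)`!%:R * S y.
  rewrite deriv_delta /deriv big_option tNN [_ * y None]mulrC; congr (_ + _).
  rewrite mulr_sumr [RHS]big_mkcond; apply: eq_bigr => e _.
  by rewrite tSN; case: ifP; rewrite ?mul1r ?mul0r ?mulr0 // mulrC.
have BNN : deriv (delta R None) (deriv (delta R None) matroid_tensor) s
    = (a.+2)`!%:R by rewrite !deriv_delta tNN.
have Byy (y : vec) : deriv y (deriv y matroid_tensor) s
    = (a.+2)`!%:R * y None ^+ 2 + 2 * (a.+1)`!%:R * y None * S y
      + a`!%:R * (\sum_(e in J) \sum_(f in J | adj e f) y (Some e) * y (Some f)).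
  rewrite {1}/deriv big_option.
  have -> : deriv y matroid_tensor (None :: s) = (a.+2)`!%:R * y None + (a.+1)`!%:R * S y.
    by rewrite -BN deriv_delta.
  have -> : \sum_e (y (Some e) : R) * deriv y matroid_tensor (Some e :: s)
      = \sum_(e in J) (y (Some e) : R) * ((a.+1)`!%:R * y None
          + \sum_(f in J | adj e f) a`!%:R * y (Some f)).
    rewrite [RHS]big_mkcond; apply: eq_bigr => e _.
    rewrite /deriv big_option tNS.
    under eq_bigr do rewrite tSS.
    case: ifP => eJ; last first.
      rewrite mul0r mulr0 big1 ?addr0 ?mulr0 // => f _; by rewrite mul0r mulr0.
    rewrite mul1r mulrC [y None * _]mulrC mulrC; congr (_ * (_ + _)).
    rewrite [RHS]big_mkcond; apply: eq_bigr => f _ /=.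
    by case: ifP; rewrite ?mul1r ?mul0r ?mulr0 // mulrC.
  have -> : \sum_(e in J) (y (Some e) : R) * ((a.+1)`!%:R * y None
          + \sum_(f in J | adj e f) a`!%:R * y (Some f))
     = (a.+1)`!%:R * y None * S y
      + a`!%:R * (\sum_(e in J) \sum_(f in J | adj e f) y (Some e) * y (Some f)).
    rewrite /S !mulr_sumr -big_split; apply: eq_bigr => e _ /=.
    rewrite mulrDr mulrC; congr (_ + _); rewrite !mulr_sumr.
    by apply: eq_bigr => f _; rewrite mulrCA.
  ring.
split=> [|/eqP|y].
- by rewrite BNN ler0n.
- by rewrite BNN pnatr_eq0 eqn0Ngt fact_gt0.
rewrite BNN BN Byy.
set Q := \sum_(e in J) _.
have HZ : S y ^+ 2 <= #|J|%:R * (S y ^+ 2 - Q).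
  have -> : S y ^+ 2 - Q
      = \sum_(e in J) \sum_(f in J | ~~ adj e f) (y (Some e) : R) * y (Some f).
    rewrite expr2 mulr_suml -sumrB; apply: eq_bigr => e _.
    by apply/eqP; rewrite subr_eq addrC mulr_sumr [X in X == _](bigID (adj e)).
  apply: (sqr_sum_le_classes (fun e => y (Some e))) => //.
    by move=> e eJ /=; rewrite /adj eqxx.
  by move=> e f _ _ /=; rewrite adjC.
have Z0 : 0 <= S y ^+ 2 - Q.
  have := sqr_ge0 (S y) => h; have := le_trans h HZ.
  case: (posnP #|J|) => [J0|J0]; last by rewrite pmulr_rge0 // ltr0n.
  by rewrite /Q /S !big_pred0 ?expr0n ?subrr // => e; have := cards0_eq J0 => ->; rewrite inE.
have HZ' : S y ^+ 2 <= a.+2%:R * (S y ^+ 2 - Q).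
  by apply: le_trans HZ _; rewrite ler_wpM2r // ler_nat.
rewrite !factS !natrM.
have a0 : (0 : R) < a`!%:R by rewrite ltr0n fact_gt0.
set b := a`!%:R in a0 *.
have aE2 : a.+2%:R = a.+1%:R + 1 :> R by rewrite -natr1.
move: HZ'; rewrite aE2; set c := a.+1%:R => HZ'.
have c0 : 0 < c by rewrite ltr0n.
rewrite -subr_ge0.
set y0 := y None; set s1 := S y in HZ' *.
have -> : ((c + 1) * (c * b) * y0 + c * b * s1) ^+ 2 -
  (c + 1) * (c * b) * ((c + 1) * (c * b) * y0 ^+ 2 + 2 * (c * b) * y0 * s1 + b * Q)
  = c * b ^+ 2 * ((c + 1) * (s1 ^+ 2 - Q) - s1 ^+ 2) by ring.
by apply: mulr_ge0; rewrite ?subr_ge0 // ltW // mulr_gt0 // exprn_gt0.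
Qed.

End MatroidTensor.

(** * Counting transversal independent sets *)

Section Counting.
Variables (R : realFieldType).

Lemma big_tuple_cons (T : finType) k (F : seq T -> R) :
  \sum_(e : k.+1.-tuple T) F e = \sum_x \sum_(e : k.-tuple T) F (x :: e).
Proof.
rewrite pair_big /= (reindex (fun p : T * k.-tuple T => [tuple of p.1 :: p.2])) /=.
  by [].
exists (fun e : k.+1.-tuple T => (thead e, [tuple of behead e])).
  by case=> x e _ /=; congr (_, _); apply/val_inj.
by move=> e _ /=; rewrite [RHS]tuple_eta; apply/val_inj.
Qed.

Lemma big_tuple0 (T : finType) (F : seq T -> R) :
  \sum_(e : 0.-tuple T) F e = F [::].
Proof.
rewrite (bigD1 [tuple]) //= big1 ?addr0 // => e /eqP []; exact: tuple0.
Qed.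

Lemma card_tuples_of_sets (T : finType) k (P : pred {set T}) :
  #|[set e : k.-tuple T | uniq e && P [set x in e]]|
  = (k`! * #|[set S : {set T} | P S & #|S| == k]|)%N.
Proof.
rewrite -sum1_card.
rewrite (partition_big (fun e : k.-tuple T => [set x in e])
  (mem [set S : {set T} | P S & #|S| == k])) /=; last first.
  move=> e; rewrite !inE => /andP[ue ->] /=.
  by rewrite cardsE (card_uniqP ue) size_tuple.
rewrite mulnC -sum_nat_const; apply: eq_bigr => S; rewrite inE => /andP[PS /eqP cS].
rewrite sum1_card; have -> : k`! = #|S| ^_ k by rewrite cS ffactnn.
rewrite -card_uniq_tuples.
rewrite -cardsE; congr #|pred_of_set _|; apply/setP => e; rewrite !inE unfold_in !inE.
apply/andP/andP => [[/andP[ue _] /eqP <-]|[/allP eS ue]].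
  by split=> //; apply/allP => x xe; have : x \in [set y in e] by rewrite inE.
suff eE : [set x in e] = S by rewrite ue eE PS eqxx.
apply/eqP; rewrite eqEcard cardsE (card_uniqP ue) size_tuple cS leqnn andbT.
by apply/subsetP => x; rewrite inE => /eS.
Qed.

Lemma pmap_nseq_None (T : Type) m (s : seq T) :
  pmap id (nseq m None ++ map Some s) = s.
Proof. by rewrite pmap_cat map_pK //; elim: m. Qed.

Section Ones.
Variables (J : finType).

Definition ones_some : {ffun option J -> R^o} := [ffun i => (i != None)%:R].

Lemma nonneg_ones_some : nonneg_vec ones_some.
Proof. by move=> i; rewrite ffunE ler0n. Qed.

Lemma derivs_nseq_ones w k s : symmetric_tensor w ->
  foldr deriv w (nseq k ones_some) s
  = \sum_(e : k.-tuple J) w (map Some e ++ s).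
Proof.
move=> sw; elim: k s => [|k IH] s /=.
  by rewrite (big_tuple0 (fun e => w (map Some e ++ s))).
rewrite (big_tuple_cons k (fun e => w (map Some e ++ s))) /deriv big_option.
rewrite ffunE mul0r add0r; apply: eq_bigr => j _.
rewrite ffunE mul1r -/(deriv _ _ _) IH; apply: eq_bigr => e _; apply: sw.
by rewrite perm_catC /= perm_cons perm_catC.
Qed.

End Ones.

Lemma derivs_nseq_delta (I : finType) t m (k : I) s :
  foldr deriv t (nseq m (delta R k)) s = t (nseq m k ++ s).
Proof.
elim: m s => //= m IH s; rewrite deriv_delta IH; congr t.
by elim: m {IH} => //= m ->.
Qed.

Section Lifts.
Variables (J : finType).
Local Notation E := (J * bool)%type.

(** The direction of [y_j] when it replaces the variables of both [(j, false)] and [(j, true)]. *)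
Definition lift_vec (j : J) : {ffun option E -> R^o} :=
  delta R (Some (j, false)) + delta R (Some (j, true)).

Lemma nonneg_lift_vec j : nonneg_vec (lift_vec j).
Proof. by move=> i; rewrite !ffunE addr_ge0 ?ler0n. Qed.

Lemma deriv_lift_vec j t s :
  deriv (lift_vec j) t s = t (Some (j, false) :: s) + t (Some (j, true) :: s).
Proof.
rewrite /lift_vec -[delta R (Some (j, false))]scale1r deriv_lin mul1r.
by rewrite !deriv_delta.
Qed.

(** By induction on [k]: the first index is expanded into its two lifts, and the chosen lift moves
    into the accumulator [r]. *)
Lemma sum_lifts t k r : symmetric_tensor t ->
  \sum_(i : k.-tuple J) (uniq (i ++ map fst r))%:R
     * foldr deriv t (map lift_vec i) (map Some r)
  = \sum_(e : k.-tuple E) (uniq (map fst (e ++ r)))%:R * t (map Some (e ++ r)).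
Proof.
move=> st; elim: k r => [|k IH] r.
  rewrite (big_tuple0 (fun i => (uniq (i ++ map fst r))%:R
     * foldr deriv t (map lift_vec i) (map Some r))).
  by rewrite (big_tuple0 (fun e => (uniq (map fst (e ++ r)))%:R * t (map Some (e ++ r)))).
rewrite (big_tuple_cons k (fun i => (uniq (i ++ map fst r))%:R
     * foldr deriv t (map lift_vec i) (map Some r))).
rewrite (big_tuple_cons k (fun e => (uniq (map fst (e ++ r)))%:R * t (map Some (e ++ r)))).
transitivity (\sum_(j : J) \sum_(b : bool) \sum_(e : k.-tuple E)
    (uniq (map fst ((j, b) :: e ++ r)))%:R * t (map Some ((j, b) :: e ++ r)));
  last by rewrite pair_big; apply: eq_bigr => -[j b].
apply: eq_bigr => j _; rewrite big_bool -big_split /=.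
have step b : \sum_(e : k.-tuple E) (uniq (map fst ((j, b) :: e ++ r)))%:R
      * t (map Some ((j, b) :: e ++ r))
    = \sum_(i : k.-tuple J) (uniq (j :: i ++ map fst r))%:R
        * foldr deriv t (map lift_vec i) (map Some ((j, b) :: r)).
  transitivity (\sum_(i : k.-tuple J) (uniq (i ++ map fst ((j, b) :: r)))%:R
      * foldr deriv t (map lift_vec i) (map Some ((j, b) :: r))).
    rewrite IH; apply: eq_bigr => e _.
    have p : perm_eq ((j, b) :: e ++ r) (e ++ (j, b) :: r).
      by rewrite -cat1s perm_catCA.
    by congr ((nat_of_bool _)%:R * _); [apply/perm_uniq/perm_map | apply/st/perm_map].
  apply: eq_bigr => i _; congr ((nat_of_bool _)%:R * _); apply: perm_uniq.
  by rewrite perm_sym -cat1s (perm_catCA [:: j] i).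
transitivity (\sum_(i : k.-tuple J) (uniq (j :: i ++ map fst r))%:R
        * foldr deriv t (map lift_vec i) (map Some ((j, true) :: r))
   + \sum_(i : k.-tuple J) (uniq (j :: i ++ map fst r))%:R
        * foldr deriv t (map lift_vec i) (map Some ((j, false) :: r))).
  rewrite -big_split; apply: eq_bigr => i _ /=.
  by rewrite deriv_lift_vec mulrDr addrC.
by rewrite -!step -big_split.
Qed.

End Lifts.

Section MatroidCount.
Variables (n : nat) (BM : {set {set elt n}}).

Definition independent_lifts k :=
  [set S : {set elt n} | admissible S && independent BM S & #|S| == k].

Lemma uniq_map_fst (e : seq (elt n)) :
  uniq (map fst e) = uniq e && admissible [set x in e].
Proof.
apply/idP/andP => [u|[u /forallP a]].
  have ue := map_uniq u; split=> //; apply/forallP => i; apply/negP.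
  rewrite !inE => /andP[i0 i1].
  move: u; case/splitPr: i0 i1 => p1 p2 i1.
  rewrite -cat1s !map_cat uniq_catCA /= mem_cat => /andP[/norP[n1 n2] _].
  move: i1; rewrite mem_cat inE xpair_eqE andbF orFb => /orP[] /(map_f fst).
    by rewrite (negPf n1).
  by rewrite (negPf n2).
rewrite map_inj_in_uniq // => -[i b] [j c] ie je /= ij; rewrite -{}ij in je *.
congr (_, _); apply/eqP; apply: contraT => bc; have := a i; rewrite !inE.
by case: b c ie je bc => [] [] //= -> ->.
Qed.

(** Being multi-affine in [y] forbids using both lifts of an index, so only admissible independent
    sets survive. *)
Definition transversal_tensor := multiaffine None (@lift_vec 'I_n) (@matroid_tensor R _ BM).

(** The factor [k!] counts the orderings of a set of size [k]; [m!] comes from differentiating the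
    power of the homogenizing variable. *)
Lemma derivs_transversal_tensor k m :
  foldr deriv transversal_tensor (nseq k (ones_some 'I_n) ++ nseq m (delta R None)) [::]
  = (k`! * m`! * #|independent_lifts k|)%:R.
Proof.
have st := symmetric_matroid_tensor R BM.
pose t' s := @matroid_tensor R _ BM (nseq m None ++ s).
have st' : symmetric_tensor t'.
  by move=> s s' ss'; apply: st; rewrite perm_cat2l.
have su : symmetric_tensor transversal_tensor by exact: symmetric_multiaffine.
rewrite foldr_cat derivs_nseq_ones; last exact: derivs_symmetric.
transitivity (\sum_(i : k.-tuple 'I_n) (uniq (i ++ map fst ([::] : seq (elt n))))%:R
     * foldr deriv t' (map (@lift_vec _) i) (map Some [::])).
  apply: eq_bigr => i _; rewrite derivs_nseq_delta !cats0 /transversal_tensor /multiaffine.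
  rewrite pmap_nseq_None.
  case: ifP => _; rewrite ?mul0r // mul1r.
  rewrite map_cat derivs_catC // foldr_cat map_nseq -map_comp.
  apply: eq_derivs => s; exact: derivs_nseq_delta.
rewrite sum_lifts //.
transitivity (\sum_(e in [set e : k.-tuple (elt n) |
    uniq e && (admissible [set x in e] && independent BM [set x in e])]) (m`!%:R : R)).
  rewrite [RHS]big_mkcond; apply: eq_bigr => e _ /=; rewrite [in RHS]inE.
  rewrite cats0 uniq_map_fst /t' /matroid_tensor pmap_nseq_None.
  have -> : count_mem None (nseq m None ++ map Some e) = m.
    by rewrite count_cat count_nseq /= mul1n count_map (eq_count (a2 := pred0)) ?count_pred0 ?addn0.
  by case: (uniq e) (admissible _) => [] [] /=; rewrite ?mul0r ?mul1r.
rewrite sumr_const -[LHS]mulr_natr -natrM; congr _%:R.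
rewrite (card_tuples_of_sets k (fun S => admissible S && independent BM S)).
by rewrite mulnCA mulnA.
Qed.

Lemma independent_lifts_log_concave k : (0 < k)%N -> (k <= n - 1)%N ->
  base_exchange BM ->
  ((2 * n - k + 1)%:R / (2 * n - k)%:R) * ((k + 1)%:R / k%:R)
    * #|independent_lifts k.+1|%:R * #|independent_lifts k.-1|%:R
  <= #|independent_lifts k|%:R ^+ 2 :> R.
Proof.
move=> k0 kn exch; pose m := (2 * n - k).-1.
have [j kE] : exists j, k = j.+1 by exists k.-1; lia.
have mE : (2 * n - k = m.+1)%N by rewrite /m; lia.
rewrite kE in k0 kn mE *.
have su : symmetric_tensor transversal_tensor.
  by apply: symmetric_multiaffine; exact: symmetric_matroid_tensor.
have Lu : lorentzian None (2 * n - 2) transversal_tensor.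
  apply: lorentzian_multiaffine; first exact: symmetric_matroid_tensor.
  - exact: matroid_tensor_ge0.
  - exact: nonneg_lift_vec.
  apply: lorentzian_matroid_tensor => //.
  by rewrite /elt card_prod card_ord card_bool; lia.
pose x : {ffun option 'I_n -> R^o} := ones_some 'I_n; pose o := delta R (@None 'I_n).
(* With [k = j + 1] and [m = 2n - k - 1], this takes [2n - 2] of the [2n] derivatives. Adding [o o],
   [o x] or [x x] then yields the count for [k - 1], [k] or [k + 1]. *)
pose L := nseq j x ++ nseq m o.
have [_ _ /(_ x)] : lorentzian_form o
    (fun y z => deriv y (deriv z (foldr deriv transversal_tensor L)) [::]).
  apply: (@derivs_lorentzian _ _ None 0) => //.
  - apply: multiaffine_ge0; first exact: matroid_tensor_ge0.
    exact: nonneg_lift_vec.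
  - move=> y; rewrite mem_cat !mem_nseq => /orP[] /andP[_ /eqP ->].
      exact: nonneg_ones_some.
    exact: nonneg_delta.
  by rewrite size_cat !size_nseq addn0; have -> : (j + m = 2 * n - 2)%N by lia.
have count y z a b : perm_eq (y :: z :: L) (nseq a x ++ nseq b o) ->
    deriv y (deriv z (foldr deriv transversal_tensor L)) [::]
    = (a`! * b`! * #|independent_lifts a|)%:R.
  move=> p; rewrite -derivs_transversal_tensor.
  exact: (derivs_perm (L := [:: y, z & L]) su p).
rewrite (count o o j m.+2); last first.
  by rewrite (perm_catCA [:: o; o] (nseq j x) (nseq m o)).
rewrite (count x x j.+2 m); last by [].
rewrite (count o x j.+1 m.+1); last first.
  by rewrite (perm_catCA [:: o] (nseq j.+1 x) (nseq m o)).
have -> : (2 * n - j.+1 + 1 = m.+2)%N by lia.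
rewrite mE addn1 !factS !natrM.
have p0 : (0 : R) < j`!%:R by rewrite ltr0n fact_gt0.
have q0 : (0 : R) < m`!%:R by rewrite ltr0n fact_gt0.
have c0 : (0 : R) < m.+1%:R by rewrite ltr0n.
have d0 : (0 : R) < j.+1%:R by rewrite ltr0n.
set p := j`!%:R in p0 *; set q := m`!%:R in q0 *.
set c := m.+1%:R in c0 *; set d := j.+1%:R in d0 *.
set a0 := #|independent_lifts j|%:R; set a1 := #|independent_lifts j.+1|%:R.
set a2 := #|independent_lifts j.+2|%:R; set c' := m.+2%:R; set d' := j.+2%:R.
(* [p * q * c * d] is [k! * (2n - k)!], the factor attached to the middle count. *)
move=> H; have e0 : 0 < (p * q * c * d) ^+ 2 by rewrite exprn_gt0 // !mulr_gt0.
rewrite -(ler_pM2l e0); clearbody p q c d a0 a1 a2 c' d'.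
have -> : (p * q * c * d) ^+ 2 * (c' / c * (d' / d) * a2 * a0)
    = p * (c' * (c * q)) * a0 * (d' * (d * p) * q * a2).
  by field; rewrite (gt_eqF c0) (gt_eqF d0).
by apply: le_trans H _; rewrite le_eqVlt; apply/orP; left; apply/eqP; ring.
Qed.

End MatroidCount.
End Counting.

(** * Enveloping matroids *)

Section Enveloping.
Variables (n : nat).
Implicit Types (S B : {set elt n}).

Lemma ebarK : involutive (@ebar n).
Proof. by case=> i b; rewrite /ebar /= negbK. Qed.

Lemma mem_setbar S a : (a \in setbar S) = (ebar a \in S).
Proof. by rewrite -[a in LHS]ebarK mem_imset //; exact: inv_inj ebarK. Qed.

Lemma card_setbar S : #|setbar S| = #|S|.
Proof. by rewrite card_imset //; exact: inv_inj ebarK. Qed.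

Lemma setbar_subC S : admissible S -> setbar S \subset ~: S.
Proof.
move=> /forallP aS; apply/subsetP => -[i b]; rewrite mem_setbar inE /ebar /=.
by have := aS i; case: b => /= + h; rewrite h ?andbT.
Qed.

Lemma card_elt : #|elt n| = (2 * n)%N.
Proof. by rewrite card_prod card_ord card_bool mulnC. Qed.

Lemma card_admissible S : admissible S -> (#|S| <= n)%N.
Proof.
move=> /setbar_subC /subset_leq_card; rewrite card_setbar.
have := cardsC S; rewrite card_elt; lia.
Qed.

Lemma setbar_maximal B : admissible B -> #|B| = n -> setbar B = ~: B.
Proof.
move=> aB cB; apply/eqP; rewrite eqEcard setbar_subC // card_setbar cB.
have := cardsC B; rewrite card_elt cB; lia.
Qed.

Lemma card_setI_setbar S B : admissible B -> #|B| = n ->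
  (#|S :&: B| + #|setbar S :&: B| = #|S|)%N.
Proof.
move=> aB cB; have -> : setbar S :&: B = setbar (S :&: setbar B).
  by apply/setP => a; rewrite !(inE, mem_setbar) ebarK.
by rewrite card_setbar setbar_maximal // -setDE cardsID.
Qed.

Lemma setbarI_admissible S B : admissible B -> S \subset B ->
  setbar S :&: B = set0.
Proof.
move=> aB SB; apply/setP => a; rewrite !inE mem_setbar; apply/negP => /andP[aS].
have := subsetP (setbar_subC aB) a; rewrite mem_setbar (subsetP SB) // inE.
by move=> /(_ isT) /negP.
Qed.

Variables (R : realType).

Lemma card_sum_elt (A : {set elt n}) :
  #|A|%:R = \sum_i (((i, true) \in A)%:R + ((i, false) \in A)%:R) :> R.
Proof.
rewrite -sum1_card big_mkcond natr_sum.
transitivity (\sum_i \sum_(b : bool) ((i, b) \in A)%:R : R).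
  by rewrite pair_big; apply: eq_bigr => -[i b] _ /=; case: ifP.
by apply: eq_bigr => i _; rewrite big_bool.
Qed.

(** Turns the quantity maximized by the rank function into a linear functional, so that maxima can
    be compared through convex hulls. *)
Lemma dotv_eS S B :
  dotv (eS R S) (eS R B) = #|S :&: B|%:R - #|setbar S :&: B|%:R.
Proof.
rewrite !card_sum_elt -sumrB; apply: eq_bigr => i _.
rewrite /eS !inE !mem_setbar /ebar /=.
by do 4![case: (_ \in _)] => /=; ring.
Qed.

Lemma dotv_hull (P : {set {set elt n}}) (lam : {set elt n} -> R) (w y : 'I_n -> R) :
  (forall i, y i = \sum_(B in P) lam B * eS R B i) ->
  dotv w y = \sum_(B in P) lam B * dotv w (eS R B).
Proof.
move=> yE; rewrite /dotv; under eq_bigr do rewrite yE mulr_sumr.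
rewrite exchange_big; apply: eq_bigr => B _; rewrite mulr_sumr.
by apply: eq_bigr => i _; rewrite mulrCA.
Qed.

Lemma in_hull_vertex (I m : finType) (P : {set I}) (f : I -> m -> R) (b : I) :
  b \in P -> in_hull P f (f b).
Proof.
move=> bP; exists (fun c => (c == b)%:R); split=> [c _|]; first exact: ler0n.
split=> [|k]; rewrite (bigD1 b) //= eqxx big1 ?addr0 ?mul1r //.
  by move=> c /andP[_ /negPf ->].
by move=> c /andP[_ /negPf ->]; rewrite mul0r.
Qed.

Variables (F BM : {set {set elt n}}).
Hypothesis D : delta_matroid R F.
Hypothesis M : enveloping_matroid R F BM.

(** The functional [e_B] takes the value [n] at [e_B] and at most [n] at every [e_B'], with equality
    only for [B' = B]. When [e_B] is written as a convex combination of images of bases, every base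
    of nonzero weight is therefore [B]. *)
Lemma feasible_base B : B \in F -> B \in BM.
Proof.
move=> BF; have [_ [/(_ B BF)[aB cB] _]] := D; have [_ envM] := M.
have [x [[lam [lam0 [lam1 xE]]] yE]] := (envM (eS R B)).2 (in_hull_vertex _ BF).
have yE' i : eS R B i = \sum_(B' in BM) lam B' * eS R B' i.
  rewrite yE /env !xE -sumrB; apply: eq_bigr => B' _; rewrite -mulrBr; congr (_ * _).
have BB : dotv (eS R B) (eS R B) = n%:R.
  by rewrite dotv_eS setIid cB setbarI_admissible // cards0 subr0.
have dn B' : dotv (eS R B) (eS R B') <= n%:R.
  rewrite dotv_eS lerBlDr -natrD ler_nat.
  by have := subset_leq_card (subsetIl B B'); rewrite cB; lia.
have : \sum_(B' in BM) lam B' * (n%:R - dotv (eS R B) (eS R B')) = 0.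
  under eq_bigr do rewrite mulrBr.
  by rewrite sumrB -mulr_suml lam1 mul1r -(dotv_hull _ yE') BB subrr.
move/eqP; rewrite psumr_eq0 => [|B' B'M]; last by rewrite mulr_ge0 ?lam0 // subr_ge0.
move=> /allP z.
have [B' B'M lamB'] : exists2 B', B' \in BM & lam B' != 0.
  apply/exists_inP; apply: contraTT (oner_neq0 R) => /exists_inPn l0.
  by rewrite negbK -lam1 big1 // => B' /l0; rewrite negbK => /eqP.
have := z B' (mem_index_enum _); rewrite B'M /= mulf_eq0 (negPf lamB') /= subr_eq0.
rewrite dotv_eS eq_sym subr_eq -natrD eqr_nat => /eqP h.
have hB : (#|B :&: B'| <= n)%N by have := subset_leq_card (subsetIl B B'); rewrite cB.
have c0 : #|setbar B :&: B'| = 0%N by lia.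
have BB' : B \subset B'.
  by apply/setIidPl/eqP; rewrite eqEcard subsetIl /= cB h leq_addr.
have B'B : B' \subset B.
  by rewrite -[B]setCK -(setbar_maximal aB cB) -disjoints_subset -setI_eq0 setIC -cards_eq0 c0.
by have -> : B = B' by apply/eqP; rewrite eqEsubset BB'.
Qed.

(** A feasible [B0] maximizing the functional [e_S] also maximizes it over all bases, by the
    envelope property. If [s] in [S] were missing from [B0], dual exchange with a base containing
    [S] would add [s] and remove some [y] outside [S], raising the value. *)
Lemma independent_sub_feasible S : admissible S -> independent BM S ->
  exists2 B, B \in F & S \subset B.
Proof.
move=> aS /independentP[B BBM SB]; have [/set0Pn[B1 B1F] [_ _]] := D.
have [[_ exch] envM] := M.
case: (@Order.TotalTheory.arg_maxP _ _ _ B1 (mem F) (fun B => dotv (eS R S) (eS R B)) B1F).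
move=> B0 B0F max0; exists B0 => //.
have maxM B' : B' \in BM -> dotv (eS R S) (eS R B') <= dotv (eS R S) (eS R B0).
  move=> B'M; have [lam [lam0 [lam1 yE]]] : in_hull F (@eS R n) (eS R B').
    apply/envM; exists (uS R B'); split=> //; exact: in_hull_vertex.
  rewrite (dotv_hull _ yE) -[leRHS]mul1r -lam1 mulr_suml; apply: ler_sum => B'' B''F.
  by rewrite ler_wpM2l ?lam0 //; exact: max0.
apply/subsetP => s sS; apply: contraT => sB0.
have B0M := feasible_base B0F.
have [|y] := base_exchange_dual exch B0M BBM (x := s).
  by rewrite inE sB0 (subsetP SB).
rewrite inE => /andP[yB yB0] /maxM.
have yS : y \notin S by apply: contraNN yB; exact: (subsetP SB).
rewrite !dotv_eS.
have -> : S :&: (s |: (B0 :\ y)) = s |: (S :&: B0).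
  apply/setP => z; rewrite !inE; case: (eqVneq z s) => [->|_] /=; first by rewrite sS.
  by case: (eqVneq z y) => [->|_] //=; rewrite (negPf yS).
rewrite cardsU1 !inE (negPf sB0) andbF /= natrD.
have : (#|setbar S :&: (s |: (B0 :\ y))| <= #|setbar S :&: B0|)%N.
  apply: subset_leq_card; apply/subsetP => z; rewrite !inE => /andP[zS].
  case: (eqVneq z s) => [zs|_] /=; last by rewrite zS => /andP[].
  by have := subsetP (setbar_subC aS) z zS; rewrite inE zs sS.
rewrite -(ler_nat R); lra.
Qed.

Lemma rank_fn_attained S : exists2 B, B \in F &
  rank_fn F S = (#|S :&: B|)%:Z - (#|setbar S :&: B|)%:Z.
Proof.
have [/set0Pn[B1 B1F] [FP _]] := D; rewrite /rank_fn.
have [|B BF ->] := Order.TotalTheory.eq_bigmax (x := - n%:Z) B1 (mem F)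
  (fun B => (#|S :&: B|)%:Z - (#|setbar S :&: B|)%:Z) B1F; last by exists B.
move=> B BF; have [_ cB] := FP B BF.
(* Each term is at least [- n], so the seed of the maximum is harmless. *)
have := subset_leq_card (subsetIr (setbar S) B); rewrite cB; lia.
Qed.

(** For [B] attaining the rank, [#|S|] minus the rank is twice [#|setbar S :&: B|], which is zero
    exactly when [S] lies in [B]. *)
Lemma defect_eq0 S : admissible S ->
  (`|(#|S|)%:Z - rank_fn F S|%N %/ 2 == 0)%N = independent BM S.
Proof.
move=> aS; have [B BF rE] := rank_fn_attained S.
have [_ [FP _]] := D; have [aB cB] := FP B BF.
have cS := card_setI_setbar S aB cB.
have -> : (`|(#|S|)%:Z - rank_fn F S|%N %/ 2 = #|setbar S :&: B|)%N by rewrite rE; lia.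
apply/eqP/idP => [c0|iS].
  apply/independentP; exists B; first exact: feasible_base.
  by apply/setIidPl/eqP; rewrite eqEcard subsetIl /= -[leqLHS]cS c0 addn0.
have [B0 B0F SB0] := independent_sub_feasible aS iS.
have [aB0 _] := FP B0 B0F.
have : (#|S :&: B0|)%:Z - (#|setbar S :&: B0|)%:Z <= rank_fn F S.
  exact: (Order.TotalTheory.le_bigmax_cond _
    (fun B => (#|S :&: B|)%:Z - (#|setbar S :&: B|)%:Z) B0F).
rewrite (setIidPl SB0) setbarI_admissible // cards0 rE; lia.
Qed.

Lemma Ucoef_independent_lifts k : (k <= n)%N ->
  Ucoef F k = #|independent_lifts BM k|%:Z.
Proof.
move=> kn; rewrite /Ucoef /Upoly_v0 coef_map_id0 ?horner0 // /Upoly coef_sum.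
rewrite horner_sum -[RHS]natz -sum1_card natr_sum [RHS]big_mkcond [LHS]big_mkcond /=.
apply: eq_bigr => S _; rewrite inE; case aS : (admissible S) => //=.
rewrite coefCM coefXn hornerM hornerXn expr0n.
have cS := card_admissible aS.
(* Truncated subtraction loses nothing here, since [k] and [#|S|] are both at most [n]. *)
have -> : ((n - k == n - #|S|) = (#|S| == k))%N by apply/eqP/eqP; lia.
rewrite -defect_eq0 //.
by case: eqP => _ /=; case: eqP => _; rewrite ?hornerC ?mulr0 ?mul0r ?mulr1.
Qed.

End Enveloping.

Theorem theorem1p6 (R : realType) (n : nat) (F : {set {set elt n}}) :
  delta_matroid R F ->
  (exists BM : {set {set elt n}}, enveloping_matroid R F BM) ->
  forall k : nat, (1 <= k)%N -> (k <= n - 1)%N ->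
    ((2 * n - k + 1)%:R / (2 * n - k)%:R) * ((k + 1)%:R / k%:R)
      * (Ucoef F k.+1)%:~R * (Ucoef F k.-1)%:~R
    <= ((Ucoef F k)%:~R : R) ^+ 2.
Proof.
move=> D [BM M] k k1 kn; have [[_ exch] _] := M.
rewrite !(Ucoef_independent_lifts D M); [|lia..].
exact: independent_lifts_log_concave.
Qed.
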